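(* Let $n$ be an even positive integer. If $T(n) = \frac{3}{2}n+1$, then an optimal flipping sequence of $\overline{I_n}$ cannot start with a flip $(n)$ (a waste), followed by all further wastes, then a flip $(n)$ (an improve), followed by all further improves. That is, there is no sequence of flips $(k_1),\dots,(k_m)$ with $m=T(n)$ transforming $\overline{I_n}$ into $I_n$ for which there is an index $j$ with $2\le j\le m$ such that $k_1=n$ and the first flip is a waste, the flips number $2,\dots,j-1$ are all wastes, $k_j=n$ and the $j$-th flip is an improve, and the flips number $j+1,\dots,m$ are all improves.
   Context: A (burnt) stack of $n$ pancakes is a sequence $[x_1,\dots,x_n]$, read from top to bottom, of nonzero integers such that $|x_1|,\dots,|x_n|$ is a permutation of $1,\dots,n$; a negative sign means that the burnt side of the pancake is face-up. For $1\le k\le n$, the flip $(k)$ transforms $[x_1,\dots,x_n]$ into $[-x_k,-x_{k-1},\dots,-x_1,x_{k+1},\dots,x_n]$. Let $I_n=[1,2,\dots,n]$ (the sorted stack) and $\overline{I_n}=[-1,-2,\dots,-n]$. $T(n)$ denotes the minimum number of flips required to transform $\overline{I_n}$ into $I_n$; a flipping sequence of $\overline{I_n}$ is a sequence of flips transforming $\overline{I_n}$ into $I_n$, and it is optimal if it has $T(n)$ flips. An adjacency in a stack is a pair of consecutive pancakes of the form $[s,s+1]$ or $[-(s+1),-s]$ with $1\le s\le n$, where a virtual immovable pancake $\pm(n+1)$ is placed below the bottom of the stack; so the bottom pancake forms an adjacency with the virtual pancake exactly when it equals $n$. A flip transforming a stack $H_1$ into $H_2$ is an improve if the number of adjacencies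 in $H_2$ is strictly larger than the number of adjacencies in $H_1$; otherwise it is a waste.
   Formalization: The formal theorem assumes n > 2: for n = 2 the claim is false, since T(2) = 4 and the optimal flips (2),(1),(2),(1) are waste, waste, improve, improve, with first and third flips equal to (n). *)

(* Defs.v *)
From mathcomp Require Import all_boot all_order all_algebra.

Set Implicit Arguments.
Unset Strict Implicit.
Unset Printing Implicit Defensive.

(* A stack is listed from top to bottom, a negative entry being a pancake whose
   burnt side is up; positions of flips are counted from 1. *)
Definition is_stack (n : nat) (s : seq int) : bool :=
  perm_eq [seq absz x | x <- s] (iota 1 n).

Definition flip (s : seq int) (k : nat) : seq int :=
  rev [seq (- x)%R | x <- take k s] ++ drop k s.

Definition flips (s : seq int) (ks : seq nat) : seq int := foldl flip s ks.

Definition sorted_stack (n : nat) : seq int := [seq Posz i | i <- iota 1 n].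

Definition burnt_stack (n : nat) : seq int := [seq (- Posz i)%R | i <- iota 1 n].

Definition flipping_sequence (n : nat) (ks : seq nat) : bool :=
  all (fun k => 1 <= k <= n) ks &&
  (flips (burnt_stack n) ks == sorted_stack n).

Lemma size_flip s k : size (flip s k) = size s.
Proof.
by rewrite size_cat size_rev size_map -size_cat cat_take_drop.
Qed.

Lemma is_stack_flip n s k : is_stack n s -> is_stack n (flip s k).
Proof.
rewrite /is_stack /flip => st; apply: perm_trans st.
rewrite map_cat map_rev -map_comp.
have /eq_map-> : absz \o (@GRing.opp int) =1 absz by move=> x; rewrite /= abszN.
rewrite -[X in perm_eq _ (map _ X)](cat_take_drop k s) map_cat.
by rewrite perm_cat2r perm_rev.
Qed.

Lemma is_stack_sorted n : is_stack n (sorted_stack n).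
Proof. by rewrite /is_stack -map_comp map_id_in. Qed.

Lemma is_stack_burnt n : is_stack n (burnt_stack n).
Proof.
by rewrite /is_stack -map_comp map_id_in // => x _; rewrite /= abszN.
Qed.

Lemma flip_cat u v : flip (u ++ v) (size u) = rev [seq (- x)%R | x <- u] ++ v.
Proof. by rewrite /flip take_size_cat // drop_size_cat. Qed.

(* The flips (k), (1), (k) turn over the k-th pancake in place. *)
Lemma flip_in_place s x t :
  flips (s ++ x :: t) [:: (size s).+1; 1; (size s).+1]
  = s ++ (- x)%R :: t.
Proof.
rewrite /flips /= -!cat_rcons -{1}(size_rcons s x) flip_cat map_rcons rev_rcons.
rewrite {2}/flip /= take0 drop0 GRing.opprK.
set u := x :: rev [seq (- y)%R | y <- s].
rewrite -[rev (x :: _) ++ _]/(u ++ t).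
have -> : (size s).+1 = size u by rewrite /u /= size_rev size_map.
rewrite flip_cat /u /= rev_cons map_rev revK -map_comp map_id_in //.
by move=> y _; rewrite /= GRing.opprK.
Qed.

Lemma ex_flipping_sequence n : exists ks, flipping_sequence n ks.
Proof.
suff [ks okks Eks] : exists2 ks, all (fun k => 1 <= k <= n) ks &
    flips (burnt_stack n) ks = sorted_stack n.
  by exists ks; rewrite /flipping_sequence okks Eks eqxx.
suff H m : m <= n -> exists2 ks, all (fun k => 1 <= k <= n) ks &
    flips (burnt_stack n) ks =
    sorted_stack m ++ [seq (- Posz i)%R | i <- iota m.+1 (n - m)].
  by have [ks] := H n (leqnn n); rewrite subnn cats0; exists ks.
elim: m => [|m IHm] lemn; first by exists [::]; rewrite // subn0.
have [ks okks Eks] := IHm (ltnW lemn).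
exists (ks ++ [:: m.+1; 1; m.+1]).
  by rewrite all_cat okks /= lemn (leq_ltn_trans _ lemn).
have sz : size (sorted_stack m) = m by rewrite size_map size_iota.
have := flip_in_place (sorted_stack m) (- Posz m.+1)%R
  [seq (- Posz i)%R | i <- iota m.+2 (n - m.+1)].
rewrite /flips foldl_cat -/(flips _ ks) Eks sz -(subnSK lemn) => ->.
rewrite GRing.opprK.
suff -> : sorted_stack m.+1 = rcons (sorted_stack m) (Posz m.+1).
  by rewrite cat_rcons.
by rewrite /sorted_stack -[in LHS](addn1 m) iotaD map_cat cats1 add1n.
Qed.

Definition sortable_in (n m : nat) : bool :=
  [exists ks : m.-tuple 'I_n.+1, flipping_sequence n [seq val k | k <- ks]].

Lemma sortable_inP n m :
  reflect (exists2 ks, size ks = m & flipping_sequence n ks) (sortable_in n m).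
Proof.
apply: (iffP existsP) => [[ks okks] | [ks <- okks]].
  by exists [seq val k | k <- ks]; rewrite // size_map size_tuple.
exists (map_tuple inord (in_tuple ks)); rewrite /= -map_comp map_id_in //.
case/andP: okks => /allP okks _ k /okks/andP[_ lekn] /=.
by rewrite inordK.
Qed.

Lemma ex_sortable_in n : exists m, sortable_in n m.
Proof.
have [ks okks] := ex_flipping_sequence n.
by exists (size ks); apply/sortable_inP; exists ks.
Qed.

Definition T (n : nat) : nat := ex_minn (ex_sortable_in n).

Lemma T_spec n :
  (exists2 ks, size ks = T n & flipping_sequence n ks) /\
  (forall ks, flipping_sequence n ks -> T n <= size ks).
Proof.
rewrite /T; case: ex_minnP => m /sortable_inP sm minm; split=> // ks okks.
by apply: minm; apply/sortable_inP; exists ks.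
Qed.

Definition optimal_flipping_sequence (n : nat) (ks : seq nat) : bool :=
  flipping_sequence n ks && (size ks == T n).

(* x lies immediately above y. *)
Definition adjacent (x y : int) : bool :=
  ((0 < x) && (y == x + 1) || (y < 0) && (x == y - 1))%R.

(* The virtual pancake below the bottom is taken to be n+1: with -(n+1) the
   bottom pancake could form no adjacency. *)
Definition adjacencies (s : seq int) : nat :=
  let t := rcons s (Posz (size s).+1) in
  count (fun p => adjacent p.1 p.2) (zip t (behead t)).

Definition improve (s : seq int) (k : nat) : bool :=
  adjacencies s < adjacencies (flip s k).

Definition waste (s : seq int) (k : nat) : bool := ~~ improve s k.

(* The flips of a sequence are numbered from 1. *)
Definition flip_number (ks : seq nat) (i : nat) : nat := nth 0 ks i.-1.

Definition stack_before (n : nat) (ks : seq nat) (i : nat) : seq int :=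
  flips (burnt_stack n) (take i.-1 ks).

Definition improve_at (n : nat) (ks : seq nat) (i : nat) : bool :=
  improve (stack_before n ks i) (flip_number ks i).

Definition waste_at (n : nat) (ks : seq nat) (i : nat) : bool :=
  waste (stack_before n ks i) (flip_number ks i).

(* With two pancakes, T 2 = (3 * 2) / 2 + 1 and the flips (2), (1), (2), (1) are
   optimal: two wastes followed by two improves, the first waste and the first
   improve both being the flip (n). *)
Lemma two_pancakes (ks := [:: 2; 1; 2; 1]) :
  [/\ T 2 = (3 * 2) %/ 2 + 1, optimal_flipping_sequence 2 ks,
      waste_at 2 ks 1 && waste_at 2 ks 2 & improve_at 2 ks 3 && improve_at 2 ks 4].
Proof.
have okks : flipping_sequence 2 ks by [].
have T2 : T 2 = 4.
  have [[ks' Eks' okks'] /(_ ks okks)] := T_spec 2.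
  rewrite -Eks' => le4; apply/eqP; rewrite eqn_leq le4 leqNgt; apply/negP => lt4.
  move: lt4 okks'; rewrite /flipping_sequence; clear.
  by do 4?[case: ks' => [|[|[|[|?]]] ks'] //=]; rewrite ?andbF.
by split; rewrite // /optimal_flipping_sequence okks T2.
Qed.

(* Main.v *)
Require Import Defs.
From mathcomp Require Import all_boot all_order all_algebra.
From mathcomp Require Import zify.

Set Implicit Arguments.
Unset Strict Implicit.
Unset Printing Implicit Defensive.

(** In a flipping sequence as described the first flip produces
    [n, n-1, ..., 1]. The wastes that follow create no adjacency, so counting
    adjacencies leaves exactly n improves at the end and n/2 wastes in the
    middle. Call a pair of consecutive entries a, a - 1 a descent: changing the
    signs of all pancakes makes it an adjacency. The stack [n, n-1, ..., 1] has
    n - 1 descents and a flip destroys at most one ([descents_flip]), so the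
    stack S reached just before the improving flip (n) has at least n/2 - 1 of
    them.

    An improve with x on top must place - x just above 1 - x: it is unique, if
    it exists. Consequently a stack that can be sorted by improves alone cannot
    start with a descent x, x - 1, as 1 - x does not occur in it
    ([climbs_top_no_descent]), and has no two overlapping descents, whose
    separation would lead to a descent on top ([climbs_no_double_descent]). As S
    and its reversal start with no descent, S has at most n/2 - 1 descents
    ([climbs_descents]). Both bounds are therefore attained. Hence S consists of
    -n, of n/2 - 1 descents, and of a bottom pancake; each waste destroys a
    descent, so that it never moves the bottom pancake, which is 1
    ([tight_descents_bottom]); and the last waste, which puts -n on top,
    separates n from n - 1, so that n - 1 is the upper half of a descent of S.

    The last improves are then read off S backwards. The last top is 1, the
    bottom pancake of S. An improve with x on top separates two pancakes that
    are consecutive in S, namely x - 1 and the next top y just below it; as y is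
    the upper half of a descent or the bottom pancake, x - 1 is the lower half
    of the preceding descent, and x its upper half ([late_climb_top]). So the
    upper halves of the descents of S come to the top one after the other, with
    the same signs as in S. When n - 1 is on top, n lies at the bottom and n - 1
    is not above it; since -(n - 1) does not occur in S, it never comes to the
    top afterwards, and n - 1 cannot be joined to n any more
    ([late_climb_joined]), a contradiction ([no_tight_waste_then_climb]). *)

Import GRing.Theory.
Local Open Scope ring_scope.

(** * Flips and steps between consecutive pancakes *)

Definition pancake (t : seq int) (i : nat) : int := nth (Posz 0) t i.
Arguments pancake : simpl never.

Lemma pancake_flip (t : seq int) k i : (k <= size t)%N ->
  pancake (flip t k) i =
  if (i < k)%N then - pancake t (k.-1 - i) else pancake t i.
Proof.
move=> lekt; rewrite /pancake /flip nth_cat size_rev size_map size_takel //.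
case: ltnP => ik; last by rewrite nth_drop subnKC.
rewrite nth_rev size_map size_takel // (nth_map 0) ?size_takel ?nth_take //;
  try lia.
by have -> : (k - i.+1 = k.-1 - i)%N by lia.
Qed.

(** For d = 1 these are adjacencies, for d = -1 descents; the virtual pancake
    is the last entry of t. The signs of the two entries agree because no
    pancake is 0. *)
Definition jumps (d : int) (t : seq int) : nat :=
  (\sum_(0 <= i < (size t).-1) (pancake t i.+1 == pancake t i + d)%R)%N.

(** Turning over a pair a, a + d yields - a - d, - a, so the steps inside the
    flipped part survive and only the pair at the cut changes. *)
Lemma jumps_flip d (t : seq int) k : (0 < k < size t)%N ->
  (jumps d (flip t k) + (pancake t k == pancake t k.-1 + d)%R =
   jumps d t + (pancake t k == - pancake t 0 + d)%R)%N.
Proof.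
case/andP=> k0 kt; have lekt := ltnW kt; rewrite /jumps size_flip.
have split_at F : (\sum_(0 <= i < (size t).-1) F i = \sum_(0 <= i < k.-1) F i
    + F k.-1 + \sum_(k <= i < (size t).-1) F i)%N.
  rewrite (big_cat_nat (n := k)) /=; [|lia|lia].
  by rewrite -[in X in (X + _)%N](prednK k0) big_nat_recr //= addnC.
rewrite !split_at [X in (X + _ + _ + _)%N]big_nat_rev /=.
have -> : (\sum_(0 <= i < k.-1) (pancake (flip t k) (0 + k.-1 - i.+1).+1
    == pancake (flip t k) (0 + k.-1 - i.+1) + d)%R =
    \sum_(0 <= i < k.-1) (pancake t i.+1 == pancake t i + d)%R)%N.
  apply: eq_big_nat => i /andP[_ ik]; rewrite !pancake_flip // !ifT; try lia.
  have -> : (k.-1 - (0 + k.-1 - i.+1).+1 = i)%N by lia.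
  have -> : (k.-1 - (0 + k.-1 - i.+1) = i.+1)%N by lia.
  by congr nat_of_bool; lia.
have -> : (\sum_(k <= i < (size t).-1)
      (pancake (flip t k) i.+1 == pancake (flip t k) i + d)%R =
    \sum_(k <= i < (size t).-1) (pancake t i.+1 == pancake t i + d)%R)%N.
  by apply: eq_big_nat => i /andP[ki _]; rewrite !pancake_flip // !ifF //; lia.
rewrite /= prednK // !pancake_flip // ltnn ltn_predL k0 subnn -!addnA.
by congr addn; rewrite addnCA [RHS]addnCA; congr addn; apply: addnC.
Qed.

Section Stacks.

Variables (N : nat) (t : seq int).
Hypothesis stack_t : is_stack N t.

Lemma size_stack : size t = N.
Proof. by rewrite -(size_map absz) (perm_size stack_t) size_iota. Qed.

Lemma stack_bound i : (i < N)%N -> (0 < absz (pancake t i) <= N)%N.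
Proof.
move=> iN; have : absz (pancake t i) \in [seq absz x | x <- t].
  by apply/map_f/mem_nth; rewrite size_stack.
by rewrite (perm_mem stack_t) mem_iota add1n ltnS.
Qed.

Lemma stack_inj i j : (i < N)%N -> (j < N)%N ->
  absz (pancake t i) = absz (pancake t j) -> i = j.
Proof.
move=> iN jN Eij; have U : uniq [seq absz x | x <- t].
  by rewrite (perm_uniq stack_t) iota_uniq.
apply/eqP; rewrite -(nth_uniq 0%N _ _ U) ?size_map ?size_stack //.
by rewrite !(nth_map (Posz 0)) ?size_stack // Eij.
Qed.

End Stacks.

Lemma pancake_sorted N i : (i < N)%N -> pancake (sorted_stack N) i = Posz i.+1.
Proof. by move=> iN; rewrite /pancake (nth_map 0%N) ?size_iota // nth_iota. Qed.

Lemma flips_stack n r ks : is_stack n r -> is_stack n (flips r ks).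
Proof. by elim: ks r => //= k ks IHks r sr; apply/IHks/is_stack_flip. Qed.

Lemma flips_bottom n (r : seq int) ks : size r = n.+1 ->
  all (fun k => 0 < k < n.+1)%N ks -> pancake (flips r ks) n = pancake r n.
Proof.
elim: ks r => // k ks IHks r Sr /= /andP[okk okks].
by rewrite -/(flips (flip r k) ks) IHks ?size_flip // pancake_flip ?ifF; lia.
Qed.

(** * Stacks sorted by improves only *)

(** N counts the virtual pancake, which is never moved, whence k < N. With
    x on top, the new pair is an adjacency when - x + 1 follows - x. *)
Definition improving_flip N (t : seq int) k :=
  [/\ is_stack N t, (0 < k < N)%N, pancake t k = 1 - pancake t 0
    & pancake t k != pancake t k.-1 + 1].

(** The flips themselves are not recorded, as t determines them. *)
Inductive climbs (N : nat) : nat -> seq int -> Prop :=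
| Climbs0 : climbs N 0 (sorted_stack N)
| ClimbsS p t k : improving_flip N t k -> climbs N p (flip t k) ->
    climbs N p.+1 t.

Lemma climbs_stack N p t : climbs N p t -> is_stack N t.
Proof. by case=> [|q t' k []] //; exact: is_stack_sorted. Qed.

Lemma climbsS_inv N p t : climbs N p.+1 t ->
  exists2 k, improving_flip N t k & climbs N p (flip t k).
Proof. by move=> ct; inversion_clear ct as [|? ? k]; exists k. Qed.

Lemma climbs_invariant (Inv : seq int -> Prop) N p q t :
  (forall t k, improving_flip N t k -> Inv t -> Inv (flip t k)) ->
  climbs N (p + q) t -> Inv t -> exists2 v, Inv v & climbs N q v.
Proof.
move=> stepI; elim: p t => [|p IHp] t; first by exists t.
rewrite addSn => /climbsS_inv[k imp_k ck] It.
exact: IHp ck (stepI _ _ imp_k It).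
Qed.

(** With x, x - 1 on top the only improve would need 1 - x, but that pancake
    is present as x - 1. *)
Lemma climbs_top_no_descent N p t : (1 < N)%N -> climbs N p t ->
  pancake t 1 != pancake t 0 - 1.
Proof.
move=> N1 [|{p}p {}t k [st /andP[k0 kN] tk _] _].
  by rewrite !pancake_sorted; lia.
apply/eqP => t1; have N0 : (0 < N)%N by lia.
have := stack_bound st N1; have : k = 1%N by apply: (stack_inj st) => //; lia.
move=> k1; rewrite k1 in tk; lia.
Qed.

(** Consider the improve that first cuts u, u - 1, u - 2. It does not cut above
    u - 1, since this needs 2 - u on top while u - 2 is below the cut; nor above
    u - 2, since the new top would be the descent 1 - u, - u. *)
Lemma climbs_no_double_descent N p t i : climbs N p t -> (i.+2 < N)%N ->
  pancake t i.+1 = pancake t i - 1 -> pancake t i.+2 != pancake t i.+1 - 1.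
Proof.
move=> ct; elim: ct i => {p t} [|p t k [st /andP[k0 kN] tk _] ck IHk] i iN ti.
  by rewrite !pancake_sorted in ti; lia.
apply/eqP => ti1; have St := size_stack st; have lekt : (k <= size t)%N by lia.
have [ki|ik] := leqP k i.
  have := IHk i iN; rewrite !pancake_flip // !ifF; try lia.
have [ik2|ki2] := ltnP i.+2 k.
  have /(_ ltac:(lia)) := IHk (k.-1 - i.+2)%N.
  rewrite !pancake_flip // !ifT; try lia.
  have -> : (k.-1 - (k.-1 - i.+2) = i.+2)%N by lia.
  have -> : (k.-1 - (k.-1 - i.+2).+1 = i.+1)%N by lia.
  have -> : (k.-1 - (k.-1 - i.+2).+2 = i)%N by lia.
  by lia.
have [Ek|Ek] : k = i.+1 \/ k = i.+2 by lia.
  subst k; have : 0%N = i.+2 by apply: (stack_inj st); lia.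
  by [].
have N1 : (1 < N)%N by lia.
have := climbs_top_no_descent N1 ck.
rewrite Ek !pancake_flip ?ifT /= ?subn0 ?subn1 /=; lia.
Qed.

(** Each of the q blocks 2i, 2i + 1 holds at most one set bit; if all of them
    hold one then, the last bit being clear, the set bits are pushed back to
    the even positions, starting from the last block. *)
Lemma sparse_bits_max q (b : nat -> bool) :
  (forall i, (i.+1 < q.*2)%N -> ~~ (b i && b i.+1)) ->
  ((0 < q)%N -> ~~ b q.*2.-1) ->
  (\sum_(0 <= i < q.*2) b i <= q)%N /\
  ((\sum_(0 <= i < q.*2) b i = q)%N -> forall i, (i < q)%N -> b i.*2).
Proof.
elim: q b => [|q IHq] b sparse last_b; first by rewrite big_geq.
rewrite doubleS !big_nat_recl //=.
have [||le_q eq_q] := IHq (fun i => b i.+2).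
- by move=> i iq; apply: sparse; lia.
- by move=> q0; have := last_b isT; have -> : q.+1.*2.-1 = q.*2.-1.+2 by lia.
set S := (\sum_(0 <= i < q.*2) _)%N in le_q eq_q *.
have b01 := sparse 0%N isT.
split=> [|ES i]; first by lia.
have ESq : S = q by lia.
case: i => [_|i lt_iq]; last by rewrite doubleS; apply: eq_q.
rewrite -[0.*2]/0%N.
case: (posnP q) => [q0|q_gt0].
  by move: last_b; rewrite q0 => /(_ isT); rewrite -[1.*2.-1]/1%N; lia.
have /(_ q_gt0) := eq_q ESq 0%N; rewrite -[0.*2]/0%N => b2.
by have := sparse 1%N ltac:(lia); lia.
Qed.

(** The top pair is no descent as -n - 1 is not in the stack; nor is the bottom
    pair, which the first improve, the flip (n), turns into the top pair of
    another climb. *)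
Lemma climbs_descents n s : ~~ odd n -> (2 < n)%N -> climbs n.+1 n s ->
  pancake s 0 = - Posz n -> pancake s n = Posz n.+1 ->
  (jumps (-1) s <= n./2.-1)%N /\
  (jumps (-1) s = n./2.-1 -> forall j, odd j -> (j < n.-2)%N ->
     pancake s j.+1 = pancake s j - 1).
Proof.
move=> n_even n2 cs s0 sn; have ss := climbs_stack cs; have Ss := size_stack ss.
pose b i := pancake s i.+2 == pancake s i.+1 - 1; pose q := n./2.-1.
have Eq : q.*2 = n.-2 by rewrite /q; lia.
have jumpsE : jumps (-1) s = (\sum_(0 <= i < q.*2) b i)%N.
  rewrite /jumps Ss /= Eq; have {1}-> : n = n.-2.+2 by lia.
  rewrite big_nat_recl // big_nat_recr //=.
  have -> : (n.-2.+1 = n.-1)%N by lia.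
  have -> : (n.-1.+1 = n)%N by lia.
  have := stack_bound ss (i := n.-1) ltac:(lia).
  have : absz (pancake s 1) <> absz (pancake s n).
    by move/(stack_inj ss (i := 1%N) (j := n) ltac:(lia) ltac:(lia)); lia.
  by rewrite s0 sn /b; set S := (\sum_(_ <= _ < _) _)%N; lia.
rewrite jumpsE -/q; have [||leq_q eq_q] := @sparse_bits_max q b.
- rewrite Eq => i iq; apply/negP => /andP[/eqP b0 b1].
  by case/negP: (climbs_no_double_descent cs (i := i.+1) ltac:(lia) b0).
- move=> q0; rewrite Eq /b; have -> : n.-2.-1.+2 = n.-1 by lia.
  have -> : n.-2.-1.+1 = n.-2 by lia.
  have [k [_ /andP[k0 kN] sk _] ck] : exists2 k, improving_flip n.+1 s k
      & climbs n.+1 n.-1 (flip s k).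
    by apply: climbsS_inv; rewrite prednK //; lia.
  have Ek : k = n by apply: (stack_inj ss); lia.
  have := @climbs_top_no_descent n.+1 _ _ ltac:(lia) ck.
  rewrite Ek !pancake_flip ?ifT; try lia.
  by rewrite subn0 subn1; lia.
split=> // /eq_q pairs j oddj jn.
have /eqP := pairs j./2 ltac:(lia); have -> : j./2.*2.+2 = j.+1 by lia.
by have -> : j./2.*2.+1 = j by lia.
Qed.

(** * Wastes that destroy one descent each *)

Lemma descents_flip N t k : is_stack N t -> (0 < k < N)%N ->
  (jumps (-1) t <= (jumps (-1) (flip t k)).+1)%N.
Proof.
move=> st /andP[k0 kN]; have := @jumps_flip (-1) t k; rewrite (size_stack st).
by move=> /(_ ltac:(lia)); lia.
Qed.

Lemma descents_flips N r ks : is_stack N r -> all (fun k => 0 < k < N)%N ks ->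
  (jumps (-1) r <= jumps (-1) (flips r ks) + size ks)%N.
Proof.
elim: ks r => [|k ks IHks] r sr /=; first by rewrite addn0.
case/andP=> okk okks; have := IHks _ (is_stack_flip k sr) okks.
by have := descents_flip sr okk; rewrite /flips /=; lia.
Qed.

(** If every flip destroys a descent then none is the flip (n): the pancake at
    the bottom and the virtual one form no descent. *)
Lemma tight_descents_bottom n r ks : is_stack n.+1 r ->
  all (fun k => 0 < k < n.+1)%N ks -> (0 < n)%N -> pancake r n = Posz n.+1 ->
  jumps (-1) r = (jumps (-1) (flips r ks) + size ks)%N ->
  pancake (flips r ks) n.-1 = pancake r n.-1.
Proof.
move=> sr okks n0.
elim: ks r sr okks => // k ks IHks r sr /= /andP[okk okks] rn.
have Sr := size_stack sr; have := descents_flips (is_stack_flip k sr) okks.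
rewrite -/(flips (flip r k) ks) => le_ks E.
have := @jumps_flip (-1) r k; rewrite Sr => /(_ okk) Ejumps.
have rk : pancake r k = pancake r k.-1 - 1 by apply/eqP; lia.
have kn : (k < n)%N.
  rewrite ltn_neqAle; apply/andP; split; last by lia.
  apply: contra_eq_neq rk => ->; rewrite rn.
  by have := stack_bound sr (i := n.-1) ltac:(lia); lia.
rewrite IHks //; first by rewrite pancake_flip ?ifF; lia.
- exact: is_stack_flip.
- by rewrite pancake_flip ?ifF; lia.
- lia.
Qed.

(** * The end of a climb *)

(** Every adjacent pair of t is an adjacency or comes, as it stands or turned
    over, from s: improves only create adjacencies. *)
Definition inherits (s t : seq int) := forall i, (i.+1 < size t)%N ->
  pancake t i.+1 = pancake t i + 1 \/
  exists2 j, (j.+1 < size s)%N &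
    pancake s j = pancake t i /\ pancake s j.+1 = pancake t i.+1 \/
    pancake s j = - pancake t i.+1 /\ pancake s j.+1 = - pancake t i.

Lemma inherits_flip N s t k : improving_flip N t k -> inherits s t ->
  inherits s (flip t k).
Proof.
move=> [st /andP[k0 kN] tk _] inh i; rewrite size_flip (size_stack st) => iN.
have St := size_stack st; rewrite !pancake_flip; try lia.
have [ik|ki] := ltnP i.+1 k.
  rewrite ifT; last by lia.
  have -> : (k.-1 - i = (k.-1 - i.+1).+1)%N by lia.
  have /(_ ltac:(lia)) [E|[j js [[E1 E2]|[E1 E2]]]] := inh (k.-1 - i.+1)%N.
  - by left; lia.
  - by right; exists j => //; right; rewrite !opprK.
  - by right; exists j => //; left.
have [ik|{}ki] := ltnP i k.
  have -> : (k.-1 - i = 0)%N by lia.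
  by left; have -> : i.+1 = k; lia.
by apply: inh; lia.
Qed.

(** Below its top pancake, s consists of descents, whose upper halves are at the
    odd positions since n is even, then of 1 and the virtual pancake. *)
Definition descent_pairs n s :=
  [/\ is_stack n.+1 s, pancake s n.-1 = 1
    & forall j, odd j -> (j < n.-2)%N -> pancake s j.+1 = pancake s j - 1].

(** By induction on the number i of improves to go. Let x be the top and y the
    top after the next improve, which separates - y from 1 - x. That pair comes
    from the pair x - 1, y of s, and since y is the upper half of a descent of s
    or the final 1, x - 1 is the lower half of the preceding descent. *)
Lemma late_climb_top n s t i : descent_pairs n s -> ~~ odd n -> (1 < n)%N ->
  (i.*2 <= n.-2)%N -> climbs n.+1 i t -> inherits s t ->
  pancake t 0 = pancake s (n.-1 - i.*2).
Proof.
move=> [ss s1 pairs] n_even n1 le_i ct inh.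
have Ss := size_stack ss.
elim: {i t}ct inh le_i => [|i t k imp_k ck IHk] inh le_i.
  by rewrite pancake_sorted // subn0 s1.
have := IHk (inherits_flip imp_k inh); have [st /andP[k0 kN] tk ntk] := imp_k.
have St := size_stack st.
rewrite pancake_flip ?k0 ?subn0; [|lia] => /(_ ltac:(lia)) top.
have Ek : k = k.-1.+1 by lia.
have kt : (k.-1.+1 < size t)%N by lia.
have [|[j js]] := inh k.-1 kt; first by rewrite -Ek => E; rewrite E eqxx in ntk.
set q := (n.-1 - i.*2)%N in top.
rewrite -Ek => -[[Ej _]|[Ej Ej1]].
  (* The pair cannot come from s as it stands: s contains y, not - y. *)
  have Eq : j = q by apply: (stack_inj ss); lia.
  have := stack_bound ss (i := q); rewrite Eq in Ej; lia.
have Eq : j.+1 = q by apply: (stack_inj ss); lia.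
have -> : (n.-1 - i.+1.*2 = j.-1)%N by lia.
have := pairs j.-1 ltac:(lia) ltac:(lia).
by have -> : j.-1.+1 = j; lia.
Qed.

(** To be joined to n at the bottom, n - 1 would have to come to the top as
    -(n - 1), but the tops of the last improves are entries of s. *)
Lemma late_climb_joined n s t i : descent_pairs n s -> ~~ odd n -> (2 < n)%N ->
  (forall j, (j <= n)%N -> pancake s j != - Posz n.-1) -> (i.*2 <= n.-2)%N ->
  climbs n.+1 i t -> inherits s t -> pancake t n = Posz n.+1 ->
  pancake t n.-1 = Posz n -> pancake t n.-2 = Posz n.-1.
Proof.
move=> dp n_even n2 no_s le_i ct.
elim: {i t}ct le_i => [|i t k imp_k ck IHk] le_i inh tN tn.
  by rewrite pancake_sorted; lia.
have [st /andP[k0 kN] tk ntk] := imp_k; have St := size_stack st.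
have k_n : k != n.
  by apply: contraNN ntk => /eqP->; rewrite tN tn; lia.
have top := late_climb_top dp n_even ltac:(lia) le_i (ClimbsS imp_k ck) inh.
have /(_ ltac:(lia)) := no_s (n.-1 - i.+1.*2)%N; rewrite -top => t0.
have fN : pancake (flip t k) n = Posz n.+1 by rewrite pancake_flip ?ifF; lia.
have fn : pancake (flip t k) n.-1 = Posz n by rewrite pancake_flip ?ifF; lia.
have := IHk ltac:(lia) (inherits_flip imp_k inh) fN fn.
rewrite pancake_flip; last by lia.
case: ltnP => // k2; have -> : (k.-1 - n.-2 = 0)%N by lia.
by lia.
Qed.

(** * The contradiction *)

(** Here r plays the part of [n, ..., 1] and ks that of the wastes, which leave
    just as many descents as [climbs_descents] allows. *)
Lemma no_tight_waste_then_climb n r ks : ~~ odd n -> (2 < n)%N ->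
  is_stack n.+1 r -> pancake r n = Posz n.+1 -> pancake r n.-1 = 1 ->
  all (fun k => 0 < k < n.+1)%N ks -> (0 < size ks)%N ->
  (n./2.-1 + size ks <= jumps (-1) r)%N ->
  pancake (flips r ks) 0 = - Posz n -> ~ climbs n.+1 n (flips r ks).
Proof.
move=> n_even n2 sr rn r1; case/lastP: ks => // ks k okks _ many top cs.
set s := flips r _ in top cs; have ss := climbs_stack cs.
have sn : pancake s n = Posz n.+1 by rewrite (flips_bottom (size_stack sr)).
have [le_s pairs] := climbs_descents n_even n2 cs top sn.
have le_r := descents_flips sr okks; rewrite -/s in le_r.
have {}pairs := pairs ltac:(lia).
have s1 : pancake s n.-1 = 1.
  by rewrite -r1; apply: tight_descents_bottom; rewrite // -/s; lia.
move: okks; rewrite all_rcons => /andP[/andP[k0 kN] okks].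
set t := flips r ks; have st : is_stack n.+1 t := flips_stack ks sr.
have St := size_stack st.
have Es : s = flip t k by rewrite /s /flips foldl_rcons.
have := descents_flips sr okks; rewrite -/t; rewrite size_rcons in many => le_t.
have := @jumps_flip (-1) t k; rewrite St -Es k0 kN => /(_ isT) Ejumps.
(* The last waste separates n from n - 1 and creates no descent. *)
have tk : pancake t k = pancake t k.-1 - 1 by lia.
have ntk : pancake t k != - pancake t 0 - 1 by lia.
have t_top : pancake t k.-1 = Posz n.
  by move: top; rewrite Es pancake_flip ?k0 ?subn0; lia.
have sk : pancake s k = Posz n.-1 by rewrite Es pancake_flip ?ltnn; lia.
have sk1 : pancake s k.-1 = - pancake t 0.
  by rewrite Es pancake_flip ?ifT ?subnn; lia.
have k_odd : odd k.
  apply/negPn/negP => k_even; have kn : (k < n)%N.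
    rewrite ltn_neqAle -ltnS kN andbT; apply: contra_eq_neq sk => ->.
    by rewrite sn; lia.
  have := pairs k.-1 ltac:(lia) ltac:(lia); rewrite prednK // sk1; lia.
have kn : (k < n.-1)%N.
  rewrite ltn_neqAle; apply/andP; split; last by lia.
  by apply: contra_eq_neq sk => ->; rewrite s1; lia.
(* With i improves to go, the top is the entry n - 1 of s, in position k. *)
pose i := (n.-1 - k)./2.
pose Inv v :=
  [/\ inherits s v, pancake v n = Posz n.+1 & pancake v n.-1 = Posz n].
have [|k' imp' cs'] := @climbsS_inv n.+1 n.-1 s.
  by rewrite prednK //; lia.
have [_ /andP[k'0 k'N] sk' _] := imp'; have Ss := size_stack ss.
have Ek' : k' = n by apply: (stack_inj ss); lia.
have [v [inh vn vn1] cv] : exists2 v, Inv v & climbs n.+1 i v.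
  apply: (@climbs_invariant Inv n.+1 (n.-1 - i)%N i (flip s k')).
  - move=> u j imp_j [inh un un1]; have [su /andP[j0 jN] uj nuj] := imp_j.
    have Su := size_stack su.
    have jn : j != n by apply: contraNN nuj => /eqP->; rewrite un un1; lia.
    by split; [exact: inherits_flip imp_j inh|..];
       rewrite pancake_flip ?ifF; lia.
  - by have -> : (n.-1 - i + i = n.-1)%N by lia.
  split; [apply: inherits_flip imp' _|..].
  - by move=> j js; right; exists j => //; left.
  - by rewrite pancake_flip ?ifF; lia.
  - by rewrite pancake_flip ?ifT ?Ek' ?subnn; lia.
have no_s j : (j <= n)%N -> pancake s j != - Posz n.-1.
  move=> jn; apply/eqP => sj; have jk : j = k by apply: (stack_inj ss); lia.
  by rewrite jk sk in sj; lia.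
have le_i : (i.*2 <= n.-2)%N by lia.
have dp : descent_pairs n s by [].
have := late_climb_top dp n_even ltac:(lia) le_i cv inh.
have -> : (n.-1 - i.*2 = k)%N by lia.
rewrite sk => v0.
have vn2 := late_climb_joined dp n_even n2 no_s le_i cv inh vn vn1.
have := stack_inj (climbs_stack cv) (i := 0%N) (j := n.-2).
by rewrite v0 vn2; lia.
Qed.

(** * Counting adjacencies along the flipping sequence *)

Lemma flips_rcons (s : seq int) z ks : all (fun k => k <= size s)%N ks ->
  flips (rcons s z) ks = rcons (flips s ks) z.
Proof.
elim: ks s => //= k ks IHks s /andP[lek oks].
have -> : flip (rcons s z) k = rcons (flip s k) z.
  rewrite /flip -cats1 takel_cat // drop_cat.
  by case: ltngtP lek => // [_|->] _;
     rewrite ?cats1 -?rcons_cat // drop_size subnn drop0 cats0 -cats1.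
by rewrite IHks // size_flip.
Qed.

Lemma is_stack_rcons n s : is_stack n s -> is_stack n.+1 (rcons s (Posz n.+1)).
Proof.
rewrite /is_stack map_rcons => st; rewrite -[in iota 1 _](addn1 n) iotaD add1n.
by rewrite cats1 -!cats1 perm_cat2r.
Qed.

Lemma adjacenciesE n s : is_stack n s ->
  adjacencies s = jumps 1 (rcons s (Posz n.+1)).
Proof.
move=> st; have Es : size s = n by exact: size_stack st.
have ST := is_stack_rcons st; have SS := size_stack ST.
rewrite /adjacencies /jumps Es; set t := rcons _ _ in ST SS *.
rewrite -sum1_count big_mkcond /= (big_nth (Posz 0, Posz 0)).
rewrite size_zip size_behead SS /= (minn_idPr _) //.
apply: eq_big_nat => i /andP[_ iN].
rewrite nth_zip_cond size_zip size_behead SS (minn_idPr _) // iN /=.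
rewrite nth_behead -/(pancake t i) -/(pancake t i.+1) /adjacent.
have := stack_bound ST (i := i) ltac:(lia).
have := stack_bound ST (i := i.+1) ltac:(lia).
case: ifP; lia.
Qed.

Lemma improve_step n s k : is_stack n s -> (0 < k <= n)%N -> improve s k ->
  improving_flip n.+1 (rcons s (Posz n.+1)) k.
Proof.
move=> st okk; have sf := is_stack_flip k st; have ST := is_stack_rcons st.
have fT := @flips_rcons s (Posz n.+1) [:: k].
rewrite /= (size_stack st) andbT in fT.
rewrite /improve (adjacenciesE st) (adjacenciesE sf) -fT; last by lia.
have := @jumps_flip 1 (rcons s (Posz n.+1)) k; rewrite (size_stack ST).
move=> /(_ okk) E lt; split; [by []|by []| |]; last by lia.
by have /eqP-> : pancake (rcons s (Posz n.+1)) k ==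
     - pancake (rcons s (Posz n.+1)) 0 + 1; lia.
Qed.

Lemma adjacencies_flip n s k : is_stack n s -> (0 < k <= n)%N ->
  (adjacencies (flip s k) <= (adjacencies s).+1)%N.
Proof.
move=> st okk; have sf := is_stack_flip k st; have ST := is_stack_rcons st.
have fT := @flips_rcons s (Posz n.+1) [:: k].
rewrite /= (size_stack st) andbT in fT.
rewrite (adjacenciesE st) (adjacenciesE sf) -fT; last by lia.
have := @jumps_flip 1 (rcons s (Posz n.+1)) k; rewrite (size_stack ST).
by move=> /(_ okk); lia.
Qed.

Lemma rcons_sorted n : rcons (sorted_stack n) (Posz n.+1) = sorted_stack n.+1.
Proof.
by rewrite /sorted_stack -[in RHS](addn1 n) iotaD map_cat cats1 add1n.
Qed.

Lemma improves_climbs n s ks : is_stack n s -> all (fun k => 0 < k <= n)%N ks ->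
  flips s ks = sorted_stack n ->
  (forall i, (i < size ks)%N -> improve (flips s (take i ks)) (nth 0%N ks i)) ->
  climbs n.+1 (size ks) (rcons s (Posz n.+1)).
Proof.
elim: ks s => [|k ks IHks] s st /=.
  by move=> _ ->; rewrite rcons_sorted => _; apply: Climbs0.
case/andP=> okk okks sorted imp; have := imp 0%N isT; rewrite /= => imp_k.
apply: ClimbsS (improve_step st okk imp_k) _.
have := @flips_rcons s (Posz n.+1) [:: k].
rewrite /= (size_stack st) => ->; last by lia.
apply: IHks => //; first exact: is_stack_flip.
by move=> i ik; apply: (imp i.+1).
Qed.

Lemma wastes_adjacencies n s ks :
  is_stack n s -> all (fun k => 0 < k <= n)%N ks ->
  (forall i, (i < size ks)%N -> waste (flips s (take i ks)) (nth 0%N ks i)) ->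
  (adjacencies (flips s ks) <= adjacencies s)%N.
Proof.
elim: ks s => // k ks IHks s st /= /andP[okk okks] was.
have := was 0%N isT; rewrite /waste /improve /= -leqNgt; apply: leq_trans.
by apply: IHks => // [|i ik]; [exact: is_stack_flip|exact: (was i.+1)].
Qed.

Lemma improves_adjacencies n s ks :
  is_stack n s -> all (fun k => 0 < k <= n)%N ks ->
  (forall i, (i < size ks)%N -> improve (flips s (take i ks)) (nth 0%N ks i)) ->
  adjacencies (flips s ks) = (adjacencies s + size ks)%N.
Proof.
elim: ks s => [|k ks IHks] s st /=; first by rewrite addn0.
case/andP=> okk okks imp; have := imp 0%N isT; rewrite /improve /= => lt.
have le := adjacencies_flip st okk.
rewrite -/(flips (flip s k) ks) IHks //; first by lia.
  exact: is_stack_flip.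
by move=> i ik; apply: (imp i.+1).
Qed.

Lemma pancake_burnt n i : (i < n)%N -> pancake (burnt_stack n) i = - Posz i.+1.
Proof. by move=> iN; rewrite /pancake (nth_map 0%N) ?size_iota // nth_iota. Qed.

Lemma adjacencies_burnt n : (0 < n)%N -> adjacencies (burnt_stack n) = 0%N.
Proof.
move=> n0; have st := is_stack_burnt n; rewrite (adjacenciesE st) /jumps.
rewrite size_rcons (size_stack st) /=; apply: big1_seq => i /=.
rewrite mem_index_iota => /andP[_ iN].
rewrite /pancake !nth_rcons (size_stack st) iN.
rewrite -!/(pancake _ _) (pancake_burnt iN).
case: ltnP => ii; first by rewrite pancake_burnt; lia.
have -> : i.+1 = n by lia.
by rewrite eqxx; lia.
Qed.

Lemma adjacencies_sorted n : adjacencies (sorted_stack n) = n.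
Proof.
have st := is_stack_sorted n; rewrite (adjacenciesE st) rcons_sorted /jumps.
rewrite (size_stack (is_stack_sorted _)) /= (eq_big_nat _ _ (F2 := fun=> 1%N)).
  by rewrite sum_nat_const_nat subn0 muln1.
by move=> i /andP[_ iN]; rewrite !pancake_sorted; lia.
Qed.

Lemma reversed_stack_descents n : (0 < n)%N ->
  let r := rcons (flip (burnt_stack n) n) (Posz n.+1) in
  [/\ is_stack n.+1 r, pancake r n = Posz n.+1, pancake r n.-1 = 1
    & (jumps (-1) r = n.-1)%N].
Proof.
move=> n0 r; have sf := is_stack_flip n (is_stack_burnt n).
have Sf := size_stack sf; have sr := is_stack_rcons sf; rewrite -/r in sr.
have rn : pancake r n = Posz n.+1 by rewrite /pancake nth_rcons Sf ltnn eqxx.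
have ri i : (i < n)%N -> pancake r i = Posz (n - i)%N.
  move=> iN; rewrite /pancake nth_rcons Sf iN -/(pancake _ _) pancake_flip.
    by rewrite iN pancake_burnt; lia.
  by rewrite (size_stack (is_stack_burnt n)).
split=> //; first by rewrite ri; lia.
rewrite /jumps (size_stack sr) /=; have {1}-> : n = n.-1.+1 by lia.
rewrite big_nat_recr //= (eq_big_nat _ _ (F2 := fun=> 1%N)).
  rewrite sum_nat_const_nat subn0 muln1 prednK // rn ri; lia.
by move=> i /andP[_ iN]; rewrite !ri; lia.
Qed.

Local Close Scope ring_scope.

Theorem theorem5 (n : nat) (n_gt2 : 2 < n) (n_even : ~~ odd n)
    (Tn : T n = (3 * n) %/ 2 + 1) :
  ~ (exists (ks : seq nat) (j : nat),
      optimal_flipping_sequence n ks /\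
      2 <= j <= size ks /\
      (flip_number ks 1 = n /\ waste_at n ks 1) /\
      (forall i : nat, 2 <= i < j -> waste_at n ks i) /\
      (flip_number ks j = n /\ improve_at n ks j) /\
      (forall i : nat, j < i <= size ks -> improve_at n ks i)).
Proof.
move=> [ks [j [/andP[/andP[okks /eqP sorted] /eqP Sks] [/andP[j2 jm]
  [[first_n waste1] [wastes [[flip_j improve_j] improves]]]]]]].
have {}wastes i : 0 < i < j -> waste_at n ks i.
  by case: i => [|[|i]] // ij; apply: wastes; lia.
have {}improves i : j <= i <= size ks -> improve_at n ks i.
  by rewrite leq_eqVlt; case: eqP => [<- //|_]; apply: improves.
pose s := flips (burnt_stack n) (take j.-1 ks).
have sb := is_stack_burnt n; have ss : is_stack n s := flips_stack _ sb.
have [ok_take ok_drop] : all (fun k => 0 < k <= n) (take j.-1 ks) /\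
    all (fun k => 0 < k <= n) (drop j.-1 ks).
  by apply/andP; rewrite -all_cat cat_take_drop.
have Es : flips s (drop j.-1 ks) = sorted_stack n.
  by rewrite /s /flips -foldl_cat cat_take_drop.
have St : size (take j.-1 ks) = j.-1 by rewrite size_takel //; lia.
have no_adjacency : adjacencies s = 0.
  apply/eqP; rewrite -leqn0 -(@adjacencies_burnt n); last by lia.
  apply: (wastes_adjacencies sb ok_take) => i; rewrite St => ij.
  have := wastes i.+1; rewrite /waste_at /stack_before /flip_number /=.
  by rewrite take_takel ?nth_take //; [apply; lia|lia].
have imp_drop i : i < size (drop j.-1 ks) ->
    improve (flips s (take i (drop j.-1 ks))) (nth 0 (drop j.-1 ks) i).
  rewrite size_drop => ij; have := improves (j.-1 + i).+1.
  rewrite /improve_at /stack_before /flip_number /= takeD nth_drop.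
  by rewrite /s /flips -foldl_cat; apply; lia.
have := improves_adjacencies ss ok_drop imp_drop.
rewrite Es adjacencies_sorted no_adjacency add0n => size_drop_n.
have climb := improves_climbs ss ok_drop Es imp_drop.
rewrite -size_drop_n in climb.
rewrite size_drop in size_drop_n.
(* This is where the value of T n enters. *)
have Ej : j.-1 = n./2.+1 by lia.
have [sr rn r1 Jr] := @reversed_stack_descents n ltac:(lia).
have Eks : take j.-1 ks = n :: behead (take j.-1 ks).
  move: first_n; rewrite /flip_number /= Ej => <-.
  by case: (ks) Sks => //=; lia.
set ws := behead _ in Eks.
have ok_ws : all (fun k => 0 < k <= n) ws.
  by move: ok_take; rewrite Eks => /andP[].
have Sws : size ws = n./2 by rewrite size_behead St Ej.
have Er : rcons s (Posz n.+1) =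
    flips (rcons (flip (burnt_stack n) n) (Posz n.+1)) ws.
  rewrite flips_rcons ?size_flip ?(size_stack sb); first by rewrite /s Eks.
  by apply: sub_all ok_ws => k /andP[].
apply: (@no_tight_waste_then_climb n _ ws _ _ sr rn r1 ok_ws) => //.
- by lia.
- by rewrite Jr Sws; lia.
- (* The virtual pancake n + 1 is 1 - x for the top x of the stack. *)
  have imp_n : improve s n by rewrite -[X in improve _ X]flip_j.
  have [_ _] := improve_step ss (k := n) ltac:(lia) imp_n.
  by rewrite -Er {1}/pancake nth_rcons (size_stack ss) ltnn eqxx; lia.
- by rewrite -Er.
Qed.
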